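(* Let $k$ be a field. (i) Let $X$ be a smooth cubic hypersurface in $\mathbb{P}_k^5$. If $X$ has a closed point of degree $8$, then $X$ has a closed point of degree $1$, $2$, $4$, $5$ or $7$. (ii) Let $X$ be a smooth cubic hypersurface in $\mathbb{P}^4_k$. If $X$ has a closed point of degree $7$, then $X$ has a closed point of degree $1$, $2$, $4$ or $5$.
   Context: The degree of a closed point $x$ on a $k$-scheme of finite type is $[\kappa(x):k]$, where $\kappa(x)$ is the residue field. The field $k$ is arbitrary. *)

(* Defs.v *)
From HB Require Import structures.
From mathcomp Require Import all_boot all_order all_algebra all_field.
From mathcomp Require Import mpoly.
From mathcomp Require boolp.
Set Implicit Arguments.
Unset Strict Implicit.
Unset Printing Implicit Defensive.
Import GRing.Theory.
Local Open Scope ring_scope.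
Local Open Scope quotient_scope.

(* ring_quotient provides {ideal_quot I} as a commutative ring only.  For I
   prime it is made an integral domain here, so that {fraction _} applies;
   the units of an arbitrary quotient are decided classically. *)
Section PrimeQuotient.
Variables (R : comNzRingType) (I : prime_idealr R).
Local Notation Q := {ideal_quot I}.

Let has_inverse (x : Q) := boolp.pselect (exists y : Q, y * x = 1).

Definition quot_unit : {pred Q} := fun x => if has_inverse x then true else false.

Definition quot_inv (x : Q) : Q :=
  if has_inverse x is left ex_y then projT1 (boolp.cid ex_y) else x.

Fact quot_mulVx : {in quot_unit, left_inverse 1 quot_inv *%R}.
Proof.
move=> x; rewrite unfold_in /quot_unit /quot_inv.
by case: has_inverse => // ex_y _; case: boolp.cid.
Qed.

Fact quot_unitPl (x y : Q) : y * x = 1 -> quot_unit x.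
Proof.
by move=> yx1; rewrite /quot_unit; case: has_inverse => // -[]; exists y.
Qed.

Fact quot_inv_out : {in [predC quot_unit], quot_inv =1 id}.
Proof.
by move=> x; rewrite inE unfold_in /quot_unit /quot_inv; case: has_inverse.
Qed.

HB.instance Definition _ := GRing.ComNzRing_hasMulInverse.Build (Quotient.quot I)
  quot_mulVx quot_unitPl quot_inv_out.
HB.instance Definition _ := GRing.ComUnitRing_isIntegral.Build (Quotient.quot I)
  (@Quotient.rquot_IdomainAxiom R I).

End PrimeQuotient.

Section Hypersurface.
Variables (k : fieldType) (n : nat).
Local Notation S := {mpoly k[n.+1]}.

(* X = V_+(F) in P^n_k = Proj S is given by F.  Its points are the homogeneous
   primes of S that contain F but not the irrelevant ideal ('X_0, ..., 'X_n). *)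
Definition homogeneous_ideal (P : {pred S}) : Prop :=
  forall f, f \in P -> forall d : nat, pihomog mdeg d f \in P.

Definition point_of (F : S) (P : prime_idealr S) : Prop :=
  [/\ homogeneous_ideal P, F \in P & exists i, 'X_i \notin P].

(* The closure of {P} consists of the points containing P as ideals. *)
Definition closed_point_of (F : S) (P : prime_idealr S) : Prop :=
  point_of F P /\
  forall Q : prime_idealr S,
    point_of F Q -> {subset P <= Q} -> {subset Q <= P}.

Definition frac_mod (P : prime_idealr S) (f : S) : {fraction {ideal_quot P}} :=
  tofrac (\pi_{ideal_quot P} f).

(* kappa(P), as the subfield of Frac(S/P) of homogeneous fractions of degree 0:
   the residue field at P of Proj S, hence also of its closed subscheme X. *)
Definition in_residue_field (P : prime_idealr S)
    (z : {fraction {ideal_quot P}}) : Prop :=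
  exists (d : nat) (f g : S),
    [/\ f \is d.-homog, g \is d.-homog, g \notin P
      & z = frac_mod P f / frac_mod P g].

(* [kappa(P) : k] = d.  As {fraction _} carries no k-algebra structure, the
   k-algebra kappa(P) is presented as the image of an extension K of k. *)
Definition point_degree (P : prime_idealr S) (d : nat) : Prop :=
  exists (K : fieldExtType k) (iota : {rmorphism K -> {fraction {ideal_quot P}}}),
    [/\ forall c : k, iota c%:A = frac_mod P c%:MP,
        forall z, in_residue_field z <-> exists a, z = iota a
      & \dim {:K} = d].

Definition has_closed_point_of_degree (F : S) (d : nat) : Prop :=
  exists2 P : prime_idealr S, closed_point_of F P & point_degree P d.

(* Smoothness of V_+(F) over k (stronger than regularity): the Jacobian
   criterion at all points with values in extensions L of k.  F(x) = 0 must be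
   kept, since Euler's formula does not give it if the characteristic divides
   the degree of F. *)
Definition smooth_hypersurface (F : S) : Prop :=
  forall (L : fieldType) (phi : {rmorphism k -> L}) (x : 'I_n.+1 -> L),
    (exists i, x i != 0) -> (map_mpoly phi F).@[x] = 0 ->
    exists i, (map_mpoly phi F^`M(i)).@[x] != 0.

Definition smooth_cubic_hypersurface (F : S) : Prop :=
  [/\ F != 0, F \is 3.-homog & smooth_hypersurface F].

End Hypersurface.

(* Main.v *)
Require Import Defs.
From HB Require Import structures.
From mathcomp Require Import all_boot all_order all_algebra all_field.
From mathcomp Require Import mpoly zify.
From mathcomp Require boolp.
Set Implicit Arguments.
Unset Strict Implicit.
Unset Printing Implicit Defensive.
Import GRing.Theory.
Local Open Scope ring_scope.
Local Open Scope quotient_scope.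

(** A closed point of degree d is a zero x of the cubic form F in an extension
   K of degree d.  If K = k(t) and, up to a common factor, the coordinates of x
   are polynomials of degree at most e in t, then they parametrise a rational
   curve of degree e through the point.  It meets the cubic in degree 3e, and
   the residual part of degree 3e - d, which is prime to 3 if d is, yields a
   zero in an extension of degree at most 3e - d and prime to 3.  The case
   e = 1, d = 2 is the descent along quadratic extensions.

   To find t for K of degree 8 in P^5 (or 7 in P^4), fix a nonzero linear
   functional l on K.  Two independent u, v in K satisfy l (u x_i) = l (v x_i) = 0
   for all i, and t = v / u.  If t generates K, duality against the power basis
   of t bounds the degree by e = d - 3, so the residual degree is 7 (or 5).  For d = 7
   this is always so.  For d = 8, a subfield of degree 4 is handled by quadratic
   descent; otherwise t generates a quadratic field L, the x_i lie up to a common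
   factor in an L-subspace of dimension 3 of the simple quartic extension K / L,
   and e = 2 leaves residual degree 2 over L. *)

(** * Residual intersection with a rational curve *)

Section Evaluation.
Variables (n : nat) (k R S : comNzRingType).

Lemma eq_mmap (phi psi : k -> R) (x y : 'I_n -> R) (F : {mpoly k[n]}) :
  phi =1 psi -> x =1 y -> mmap phi x F = mmap psi y F.
Proof.
move=> eq_phi eq_xy; apply: eq_bigr => m _; rewrite eq_phi /mmap1.
by congr (_ * _); apply: eq_bigr => i _; rewrite eq_xy.
Qed.

Lemma rmorph_mmap (g : {rmorphism R -> S}) (phi : k -> R) (x : 'I_n -> R)
    (F : {mpoly k[n]}) : g (mmap phi x F) = mmap (g \o phi) (g \o x) F.
Proof.
rewrite rmorph_sum /mmap; apply: eq_bigr => m _.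
rewrite rmorphM /mmap1 rmorph_prod; congr (_ * _).
by apply: eq_bigr => i _; rewrite rmorphXn.
Qed.

Lemma mmap_dhomog_scale (phi : k -> R) (x : 'I_n -> R) (F : {mpoly k[n]}) D c :
  F \is D.-homog -> mmap phi (fun i => c * x i) F = c ^+ D * mmap phi x F.
Proof.
move=> /dhomogP homF; rewrite mulr_sumr; apply: eq_big_seq => m mF.
have <- : mdeg m = D := homF m mF.
rewrite mulrCA; congr (_ * _); rewrite /mmap1 mdegE -prodrXr -big_split /=.
by apply: eq_bigr => i _; rewrite exprMn.
Qed.

End Evaluation.

Section TopCoefficient.
Variable R : comNzRingType.

(* The coefficient of degree a of p, viewed as a form of degree a in two variables. *)
Definition has_top (p : {poly R}) (a : nat) (c : R) :=
  (size p <= a.+1)%N /\ p`_a = c.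

Lemma has_topM p q a b c d :
  has_top p a c -> has_top q b d -> has_top (p * q) (a + b) (c * d).
Proof.
move=> [sp <-] [sq <-]; split.
  by apply: leq_trans (size_polyMleq _ _) _; lia.
rewrite coefM (bigD1 (Ordinal (leq_addr b a : a < (a + b).+1)%N)) //= addKn.
rewrite big1 ?addr0 // => i; rewrite -val_eqE /= neq_ltn => /orP[lt_ia|lt_ai].
  by rewrite [q`__]nth_default ?mulr0 //; apply: leq_trans sq _; lia.
by rewrite [p`__]nth_default ?mul0r //; apply: leq_trans sp _; lia.
Qed.

Lemma has_top_exp p a c m : has_top p a c -> has_top (p ^+ m) (a * m) (c ^+ m).
Proof.
move=> tp; elim: m => [|m IHm].
  by rewrite muln0 !expr0; split; rewrite ?size_poly1 ?coefC.
by rewrite !exprS mulnS; apply: has_topM.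
Qed.

(** By homogeneity every monomial contributes in degree [e * D]: the coefficient there is the value
    of [F] at the point at infinity of the curve [P]. *)
Lemma has_top_mmap n (k : comNzRingType) (phi : k -> R) (P : 'I_n -> {poly R})
    (F : {mpoly k[n]}) e D :
  F \is D.-homog -> (forall i, (size (P i) <= e.+1)%N) ->
  has_top (mmap (polyC \o phi) P F) (e * D) (mmap phi (fun i => (P i)`_e) F).
Proof.
move=> /dhomogP homF sP; rewrite /mmap big_seq [X in has_top _ _ X]big_seq.
apply: (big_ind2 (fun p c => has_top p (e * D) c)).
- by split; rewrite ?size_poly0 ?coef0.
- move=> p c q d [sp <-] [sq <-]; split; last by rewrite coefD.
  by apply: leq_trans (size_polyD _ _) _; rewrite geq_max sp sq.
move=> m mF; have <- : mdeg m = D := homF m mF.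
rewrite /= -[(e * mdeg m)%N]add0n; apply: has_topM.
  by split; rewrite ?size_polyC_leq1 ?coefC.
rewrite mdegE /mmap1 big_distrr /=.
apply: (big_rec3 (fun p a c => has_top p a c)).
  by split; rewrite ?size_poly1 ?coefC.
by move=> i p a c _; apply: has_topM; apply: has_top_exp; split.
Qed.

End TopCoefficient.

(** * Degrees of irreducible factors *)

Section Factor.
Variable L : fieldType.

Lemma irredp_coprimep (p q : {poly L}) :
  irreducible_poly p -> coprimep p q = ~~ (p %| q).
Proof.
move=> irr_p; have [sp _] := irr_p.
have [dpq|ndpq] := boolP (p %| q).
  apply/negbTE; rewrite /coprimep.
  by rewrite (eqp_size (dvdp_gcd_idl dpq)) neq_ltn sp orbT.
have [g1|gp] := irredp_XsubCP irr_p (dvdp_gcdl p q).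
  by rewrite /coprimep size_poly_eq1.
by case/negP: (ndpq); rewrite -(eqp_dvdl _ gp) dvdp_gcdr.
Qed.

(** Degrees add up along a factorisation, so [D] cannot divide them all if it does not divide the
    total. *)
Lemma irreducible_factor_degree (D : nat) (H : {poly L}) :
  H != 0 -> ~~ (D %| (size H).-1)%N ->
  exists p, [/\ irreducible_poly p, p %| H & ~~ (D %| (size p).-1)%N].
Proof.
have [N] := ubnP (size H); elim: N H => // N IHN H /ltnSE leHN nzH ndH.
have [irrH|redH] := boolp.EM (irreducible_poly H); first by exists H.
have sH : (1 < size H)%N.
  rewrite ltn_neqAle eq_sym size_poly_gt0 nzH andbT.
  (* A constant has degree 0, which [D] divides. *)
  by apply: contraNneq ndH => ->.
have [q [sq qH nqH]] : exists q : {poly L}, [/\ size q != 1, q %| H & ~~ (q %= H)].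
  apply: boolp.contrapT => nex; apply: redH; split=> // q sq qH.
  by apply/negPn/negP => nqH; apply: nex; exists q.
have nzq : q != 0 by apply: contraTneq qH => ->; rewrite dvd0p.
have /dvdpP [r defH] := qH.
have nzr : r != 0 by apply: contraNneq nzH => r0; rewrite defH r0 mul0r.
have sizeH : size H = (size r + size q).-1 by rewrite defH size_mul.
have [s0r s0q] : (0 < size r /\ 0 < size q)%N by rewrite !size_poly_gt0.
have sqH : (size q < size H)%N.
  rewrite ltn_neqAle (dvdp_leq nzH qH) andbT.
  by apply: contra nqH => /eqP e; rewrite -(dvdp_size_eqp qH) e.
have /orP[dq|dr] : ~~ (D %| (size q).-1)%N || ~~ (D %| (size r).-1)%N.
  rewrite -negb_and; apply: contra ndH => /andP[dq dr].
  by rewrite (_ : (size H).-1 = (size r).-1 + (size q).-1)%N ?dvdn_add //; lia.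
- have [|p [ip pq dp]] := IHN q _ nzq dq; first lia.
  by exists p; split; rewrite // (dvdp_trans pq qH).
- have [|p [ip pr dp]] := IHN r _ nzr dr; first by move: sq; lia.
  by exists p; split; rewrite // defH dvdp_mulr.
Qed.

End Factor.

Definition has_zero n (k E : comNzRingType) (phi : k -> E) (F : {mpoly k[n]}) : Prop :=
  exists2 x : 'I_n -> E, exists i, x i != 0 & mmap phi x F = 0.

Section Residual.
Variables (n D : nat) (k : comNzRingType) (L : fieldType).
Variables (phi : {rmorphism k -> L}) (F : {mpoly k[n]}).
Hypothesis homF : F \is D.-homog.

Lemma zero_regular : has_zero phi F ->
  exists E : fieldExtType L, \dim {:E} = 1%N /\ has_zero (in_alg E \o phi) F.
Proof.
move=> [x nzx Fx]; exists L^o; split; first by rewrite dimvf.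
exists (fun i => in_alg L^o (x i)).
  by case: nzx => i nz; exists i; rewrite fmorph_eq0.
have := rmorph_mmap (in_alg L^o) phi x F; rewrite Fx rmorph0; exact: esym.
Qed.

(* P parametrises a rational curve of degree e through the point defined by m.
   It meets F = 0 in a divisor of degree D * e, whose part residual to m has
   degree prime to D. *)
Lemma residual_zero (m : {poly L}) (e : nat) (P : 'I_n -> {poly L}) :
  irreducible_poly m -> ~~ (D %| (size m).-1)%N ->
  (forall i, (size (P i) <= e.+1)%N) -> (exists i, ~~ (m %| P i)) ->
  m %| mmap (polyC \o phi) P F ->
  exists E : fieldExtType L,
    [/\ (\dim {:E} <= maxn 1 (D * e - (size m).-1))%N, ~~ (D %| \dim {:E})%N
      & has_zero (in_alg E \o phi) F].
Proof.
move=> irr_m ndm.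
have nD1 : ~~ (D %| 1)%N by apply: contra ndm => /(dvdn_trans) ->; rewrite ?dvd1n.
have [N] := ubnP e; elim: N e P => // N IHN e P /ltnSE leeN sP [i0 nPi0] mF.
have [tsz tco] := has_top_mmap phi homF sP.
have nzP : P i0 != 0 by apply: contraNneq nPi0 => ->; rewrite dvdp0.
have lower e' (P' : 'I_n -> {poly L}) : (e' < e)%N ->
    (forall i, (size (P' i) <= e'.+1)%N) -> ~~ (m %| P' i0) ->
    m %| mmap (polyC \o phi) P' F ->
  exists E : fieldExtType L,
    [/\ (\dim {:E} <= maxn 1 (D * e - (size m).-1))%N, ~~ (D %| \dim {:E})%N
      & has_zero (in_alg E \o phi) F].
  move=> lte sP' nP' mP'; have [||E [dE nE zE]] := IHN e' P' _ sP' _ mP'.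
  - exact: leq_trans leeN.
  - by exists i0.
  exists E; split=> //; apply: leq_trans dE _; rewrite geq_max leq_maxl /=.
  by apply: leq_trans (leq_maxr _ _); rewrite leq_sub2r // leq_mul2l (ltnW lte) orbT.
(* If all coefficients of degree [e] vanish, [e] can be lowered; for [e = 0] this would make [P i0]
   zero. *)
have [top0 | /forallPn[i topi]] := boolP [forall i, (P i)`_e == 0].
  case: e {IHN} sP leeN lower top0 tsz tco => [|e] sP leeN lower /forallP top0 _ _.
    by case/eqP: nzP; rewrite [P i0]size1_polyC // (eqP (top0 i0)).
  apply: (lower e P) => // i; rewrite -ltnS ltn_neqAle sP andbT.
  apply: contraTneq (top0 i) => sz; rewrite -[e.+1]/(e.+2.-1) -sz -lead_coefE.
  by rewrite lead_coef_eq0 -size_poly_eq0 sz.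
set G := mmap _ P F in mF tsz tco.
(* Either the point at infinity is a zero over [L], or [G] has degree exactly [e * D] and its
   cofactor [H] has degree D e - deg m. *)
have [G0 | nzG] := eqVneq G`_(e * D) 0.
  have [|E [dE zE]] := zero_regular.
    by exists (fun i => (P i)`_e); [exists i | rewrite -tco].
  by exists E; rewrite dE leq_maxl.
have [H defG] : exists H : {poly L}, G = H * m by apply/dvdpP.
have nz_G : G != 0 by apply: contraNneq nzG => ->; rewrite coef0.
have [nzH nzm] : H != 0 /\ m != 0.
  by split; apply: contraNneq nz_G; rewrite defG => ->; rewrite ?mul0r ?mulr0.
have sG : size G = (e * D).+1.
  apply/eqP; rewrite eqn_leq tsz ltnNge; apply: contra nzG => le.
  by rewrite nth_default.
have sH : ((size H).-1 + (size m).-1 = D * e)%N.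
  have := size_mul nzH nzm; rewrite -defG sG mulnC.
  move: nzH nzm; rewrite -!size_poly_gt0; case: (size H) (size m) => [|a] [|b] //= _ _.
  by rewrite addnS => -[].
have [|p [irr_p pH ndp]] := @irreducible_factor_degree _ D H nzH.
  apply: contra ndm => dH.
  by rewrite -(dvdn_addr _ dH) sH dvdn_mulr.
have sp : (size p <= size H)%N by apply: dvdp_leq.
(* A common factor [p] of the [P i] is cancelled. It is prime to [m], because [m] does not divide
   [P i0], so [m] still divides the value of [F]. *)
have [allp | /forallPn[i1 npi1]] := boolP [forall i, p %| P i].
  have sp1 : (1 < size p)%N by case: irr_p.
  have nzp : p != 0 by rewrite -size_poly_gt0 ltnW.
  have defP i' : P i' = p * (P i' %/ p) by rewrite mulrC divpK // (forallP allp).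
  have np : ~~ (m %| p) by apply: contra nPi0 => mp; rewrite defP dvdp_mulr.
  have sdiv i' : size (P i' %/ p) = (size (P i') - (size p).-1)%N.
    by rewrite size_divp.
  have lt0e : (0 < e)%N.
    rewrite lt0n; apply: contraTneq (dvdp_leq nzP (forallP allp i0)) => e0.
    by rewrite -ltnNge; apply: leq_ltn_trans sp1; rewrite -e0.
  apply: (lower e.-1 (fun i => P i %/ p)).
  - by rewrite prednK.
  - move=> i'; rewrite sdiv prednK // leq_subLR; apply: leq_trans (sP i') _.
    by rewrite -add1n leq_add2r -ltnS prednK // ltnW.
  - by apply: contra nPi0 => mP; rewrite defP dvdp_mull.
  have : m %| p ^+ D * mmap (polyC \o phi) (fun i => P i %/ p) F.
    rewrite -(mmap_dhomog_scale _ _ _ homF).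
    by rewrite (eq_mmap (psi := polyC \o phi) (y := P)).
  rewrite Gauss_dvdpr // coprimep_expr //.
  by rewrite irredp_coprimep.
(* Otherwise a root of [p] is a parameter at which [P i1] does not vanish. *)
have [E dimE [z pz _]] := irredp_FAdjoin irr_p.
exists E; split.
- by rewrite dimE; apply: leq_trans (leq_maxr _ _); rewrite -sH addnK -!subn1 leq_sub2r.
- by rewrite dimE.
exists (fun i => (map_poly (in_alg E) (P i)).[z]).
  exists i1; apply: contra npi1 => rz.
  have nc : ~~ coprimep p (P i1).
    rewrite -(coprimep_map (in_alg E)); apply/negP => /coprimep_root/(_ pz).
    by rewrite rz.
  by move: nc; rewrite irredp_coprimep // negbK.
have /rootP G0 : root (map_poly (in_alg E) G) z.
  rewrite -dvdp_XsubCl; apply: (@dvdp_trans _ (map_poly (in_alg E) p)).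
    by rewrite dvdp_XsubCl.
  by rewrite dvdp_map defG dvdp_mulr.
pose ev := horner_eval z \o map_poly (in_alg E).
have := rmorph_mmap ev (polyC \o phi) P F.
rewrite -/G /ev /= /horner_eval G0 => ->; apply: eq_mmap => c //=.
by rewrite /horner_eval map_polyC hornerC.
Qed.

End Residual.

(** * Residual zeros over an intermediate field *)

Section Tower.
Variables (k : fieldType) (K : fieldExtType k) (L : {subfield K}).

Lemma minPoly_subvs (s : K) : exists2 M : {poly subvs_of L},
  map_poly vsval M = minPoly L s & irreducible_poly M.
Proof.
have /polyOver_subvs[M defM] := minPolyOver L s; exists M => //.
split=> [|q sq qM]; first by rewrite -(size_map_poly vsval) -defM size_minPoly.
have := @minPoly_irr _ _ L s (map_poly vsval q).
rewrite defM dvdp_map qM eqp_map -size_poly_eq1 size_map_poly => irr.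
have qL : map_poly vsval q \is a polyOver L by apply/polyOver_subvs; exists q.
case/orP: (irr qL isT) => //.
by rewrite (negPf sq).
Qed.

(** This is [residual_zero] over [L], with the minimal polynomial of [s] as [m]: it divides the
    value of [F] at [p] because that value vanishes at [s]. *)
Lemma residual_zero_tower (n D e : nat) (F : {mpoly k[n]}) (s : K)
    (p : 'I_n -> {poly K}) :
  F \is D.-homog -> ~~ (D %| adjoin_degree L s)%N ->
  (forall i, p i \is a polyOver L) -> (forall i, (size (p i) <= e.+1)%N) ->
  (exists i, (p i).[s] != 0) -> mmap (in_alg K) (fun i => (p i).[s]) F = 0 ->
  exists (E : fieldExtType k) (c : nat),
    [/\ \dim {:E} = (c * \dim L)%N, (c <= maxn 1 (D * e - adjoin_degree L s))%N,
       ~~ (D %| c)%N & has_zero (in_alg E) F].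
Proof.
move=> homF ndm pL sp [i0 nz] Fp.
have [M defM irrM] := minPoly_subvs s.
have sM : (size M).-1 = adjoin_degree L s.
  by rewrite -(size_map_poly vsval) defM size_minPoly.
have pS i : exists q : {poly subvs_of L}, p i = map_poly vsval q.
  exact/polyOver_subvs.
have [P defP] := boolp.choice pS.
have [||||E [dimE nE [x nzx Fx]]] :=
    @residual_zero n D k _ (in_alg (subvs_of L)) F homF M e P irrM.
- by rewrite sM.
- by move=> i; rewrite -(size_map_poly vsval) -defP.
- exists i0; apply: contra nz => MP; rewrite defP -/(root _ s) -dvdp_XsubCl.
  apply: dvdp_trans (_ : _ %| map_poly vsval M) _; last by rewrite dvdp_map.
  by rewrite defM dvdp_XsubCl root_minPoly.
- rewrite -(dvdp_map vsval) defM; apply: minPoly_dvdp.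
    by apply/polyOver_subvs; eexists.
  rewrite /root -[X in X == 0]/((horner_eval s \o map_poly vsval) _) rmorph_mmap -Fp.
  apply/eqP/eq_mmap => [c|i] /=; last by rewrite /horner_eval defP.
  by rewrite /horner_eval map_polyC hornerC /= algid1.
exists (baseFieldType E), (\dim {:E}).
split=> //; last first.
- exists x => //; rewrite -[RHS]Fx; apply: eq_mmap.
- by rewrite -sM.
have <- : baseVspace {:E} = fullv.
  by apply/vspaceP => y; rewrite memvf mem_baseVspace; apply: memvf.
rewrite dim_baseVspace; congr (_ * _)%N; exact: dimvf.
Qed.

End Tower.

(** * Duality with respect to a linear functional *)

Section Duality.
Variables (k : fieldType) (K : fieldExtType k) (l : 'Hom(K, k^o)).

(** [W] is the kernel of z |-> (l (u_i z))_i for a basis u_i of [U]; its codimension is at most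
    [\dim U]. *)
Lemma annihilator (U : {vspace K}) : exists2 W : {vspace K},
  (\dim {:K} <= \dim W + \dim U)%N &
  {in U & W, forall u w, l (u * w) = 0}.
Proof.
pose f (z : K) : 'rV[k]_(\dim U) := \row_i l ((vbasis U)`_i * z).
have linf : linear f.
  by move=> c y z; apply/rowP=> i; rewrite !mxE mulrDr -scalerAr linearP.
pose fL := GRing.isLinear.Build _ _ _ _ f linf.
pose g : {linear K -> 'rV[k]_(\dim U)} := HB.pack f fL.
exists (lker (linfun g)).
  rewrite -(limg_ker_dim (linfun g) fullv) capfv leq_add2l.
  apply: leq_trans (dimvS (subvf _)) _; by rewrite dimvf /dim /= mul1n.
move=> u w /coord_vbasis -> ; rewrite memv_ker lfunE => /eqP/rowP fw.
rewrite mulr_suml linear_sum big1 // => i _.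
by rewrite -scalerAl linearZ /=; have := fw i; rewrite !mxE => ->; rewrite scaler0.
Qed.

Variables (L : {subfield K}) (s : K).
Hypothesis genK : <<L; s>>%VS = fullv.
Local Notation m := (adjoin_degree L s).

(* mu is chosen so that y |-> l (y / mu) vanishes on L s^j for j < m - 1, hence only
   sees the top coefficient of y in the basis 1, s, ..., s^(m - 1). *)
Lemma dual_power_basis : l != 0 -> exists2 mu : K, mu != 0 &
  forall (y : K) (r : nat), (r <= m)%N ->
    (forall a j, a \in L -> (j < r)%N -> l (a * s ^+ j * y) = 0) ->
  exists p : {poly K},
    [/\ p \is a polyOver L, (size p <= m - r)%N & mu * y = p.[s]].
Proof.
(* Any nonzero [w] in the annihilator of [U] serves, with [mu] its inverse; it exists because \dim U
   <= (m - 1) \dim L < \dim K. *)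
move=> nzl; pose U := (\sum_(i < m.-1) L * <[s ^+ i]>)%VS.
have dimK : \dim {:K} = (m * \dim L)%N by rewrite -genK dim_Fadjoin.
have dimU : (\dim U <= m.-1 * \dim L)%N.
  apply: leq_trans (dimv_leq_sum _ _ _) _; rewrite -[X in (_ <= X * _)%N]card_ord.
  rewrite -sum_nat_const; apply: leq_sum => i _.
  have [-> | nz] := eqVneq (s ^+ i) 0; last by rewrite dim_cosetv.
  by apply: leq_trans (dim_prodv _ _) _; rewrite dim_vline eqxx muln0.
have [W dimW annW] := annihilator U.
have nzW : vpick W != 0.
  rewrite vpick0; apply: contraTneq dimW => ->; rewrite dimv0 add0n -ltnNge.
  apply: leq_ltn_trans dimU _; rewrite dimK ltn_pmul2r ?adim_gt0 //.
pose w := vpick W; have Ww : w \in W by apply: memv_pick.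
have lw a j : a \in L -> (j < m.-1)%N -> l (a * s ^+ j * w) = 0.
  move=> aL jm; apply: annW => //.
  apply: (subvP (sumv_sup (Ordinal jm) _ (subvv _))) => //.
  by apply: memv_mul => //; apply: memv_line.
have lK p : p \is a polyOver L -> (size p <= m)%N ->
    l (p.[s] * w) = l (p`_m.-1 * s ^+ m.-1 * w).
  move=> /polyOverP pL sp; rewrite (horner_coef_wide _ sp) mulr_suml linear_sum.
  rewrite big_ord_recr /= big1 ?add0r // => i _; exact: lw.
exists w^-1; first by rewrite invr_eq0.
(* Induction on [r]: each further condition kills the current top coefficient. *)
move=> y; elim=> [|r IHr] ler ly.
  exists (Fadjoin_poly L s (w^-1 * y)); rewrite Fadjoin_polyOver subn0.
  by rewrite size_Fadjoin_poly Fadjoin_poly_eq // genK memvf.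
have [a j aL jr|p [pL sp eqp]] := IHr (ltnW ler).
  by apply: ly => //; apply: ltnW.
exists p; split=> //.
have [c0|nzc] := eqVneq p`_(m - r.+1) 0.
  rewrite leqNgt; apply/negP => sp1.
  have sz : size p = (m - r.+1).+1 by apply/eqP; rewrite eqn_leq sp1 -subSn // subSS sp.
  move/eqP: c0; rewrite -[(m - r.+1)%N]/((m - r.+1).+1.-1) -sz -lead_coefE.
  by rewrite lead_coef_eq0 -size_poly_eq0 sz.
(* If the coefficient c is nonzero, (b / c) X^r p has degree at most m - 1 and top coefficient b.
   Its value at s times w is (b / c) s^r y, where [l] vanishes. *)
have ls b : b \in L -> l (b * s ^+ m.-1 * w) = 0.
  move=> bL; set c := p`__ in nzc.
  have cL : c \in L by apply/polyOverP.
  have bcL : b / c \in L by apply: rpred_div.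
  pose q := (b / c) *: 'X^r * p.
  have sq : (size q <= m)%N.
    apply: leq_trans (size_polyMleq _ _) _.
    rewrite -subn1 leq_subLR add1n -(subnKC (ltnW ler)) -addSn leq_add //.
    by apply: leq_trans (size_scale_leq _ _) _; rewrite size_polyXn.
  have qL : q \is a polyOver L.
    by apply: rpredM => //; apply: polyOverZ => //; apply: rpredX; apply: polyOverX.
  have qm : q`_m.-1 = b.
    rewrite /q -scalerAl coefZ coefXnM ifF; last by apply/negbTE; rewrite -leqNgt.
    by rewrite -subSS divfK.
  rewrite -qm -lK // hornerM hornerZ hornerXn -eqp mulrAC -!mulrA.
  by rewrite mulVKf // !mulrA ly.
(* So [l] vanishes on L s^(m - 1) w too, hence on all of K. *)
case/negP: nzl; apply/eqP/lfunP => z; rewrite zero_lfunE -(divfK nzW z).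
rewrite -(@Fadjoin_poly_eq _ _ L s (z / vpick W)) ?genK ?memvf //.
rewrite lK ?Fadjoin_polyOver ?size_Fadjoin_poly // ls //.
exact: (polyOverP (Fadjoin_polyOver _ _ _)).
Qed.

End Duality.

(** * Cubic forms over extensions of degree 7 and 8 *)

Section Descent.
Variables (k : fieldType) (K : fieldExtType k) (n D : nat) (F : {mpoly k[n]}).
Hypothesis homF : F \is D.-homog.

Lemma nonzero_functional : exists l : 'Hom(K, k^o), l != 0.
Proof.
have [i nz] : exists i, coord (vbasis {:K}) i 1 != 0.
  apply/existsP; rewrite -negb_forall; apply/negP => /forallP z.
  have /eqP[] := oner_neq0 K.
  by rewrite (coord_vbasis (memvf 1)) big1 // => i _; rewrite (eqP (z i)) scale0r.
exists (linfun (coord (vbasis {:K}) i : K -> k^o)).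
by apply: contra nz => /eqP/lfunP/(_ 1); rewrite lfunE zero_lfunE => ->.
Qed.

(** By duality the scaled coordinates mu x_i are values at [s] of polynomials of degree at most m -
    r - 1, where m is the degree of [s] over [L]; this is the degree of the curve. *)
Lemma residual_zero_dual (l : 'Hom(K, k^o)) (L : {subfield K}) (s : K)
    (r : nat) (x : 'I_n -> K) :
  l != 0 -> <<L; s>>%VS = fullv -> ~~ (D %| adjoin_degree L s)%N ->
  (r < adjoin_degree L s)%N ->
  (forall i a j, a \in L -> (j < r)%N -> l (a * s ^+ j * x i) = 0) ->
  (exists i, x i != 0) -> mmap (in_alg K) x F = 0 ->
  exists (E : fieldExtType k) (c : nat),
    [/\ \dim {:E} = (c * \dim L)%N,
       (c <= maxn 1 (D * (adjoin_degree L s - r).-1 - adjoin_degree L s))%N,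
       ~~ (D %| c)%N & has_zero (in_alg E) F].
Proof.
move=> nzl genK ndm ltr lx [i0 nzx] Fx.
have [mu nzmu dual] := dual_power_basis genK nzl.
have ex_p i : exists p : {poly K}, [/\ p \is a polyOver L,
    (size p <= adjoin_degree L s - r)%N & mu * x i = p.[s]].
  by apply: dual; [apply: ltnW | move=> *; apply: lx].
have [p pP] := boolp.choice ex_p.
apply: (@residual_zero_tower _ _ _ _ _ _ _ _ p homF ndm).
- by move=> i; case: (pP i).
- by move=> i; rewrite prednK ?subn_gt0 //; case: (pP i).
- by exists i0; have [_ _ <-] := pP i0; rewrite mulf_neq0.
rewrite (eq_mmap (psi := in_alg K) (y := fun i => mu * x i)) //.
  by rewrite (mmap_dhomog_scale _ _ _ homF) Fx mulr0.
by move=> i; case: (pP i).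
Qed.

(** The annihilator of the span of the x_i has dimension at least 2. Replacing x by u x turns two
    independent elements u, v of it into 1 and t = v / u. *)
Lemma two_annihilators (l : 'Hom(K, k^o)) (x : 'I_n -> K) :
  (n.+2 <= \dim {:K})%N -> exists u t : K,
    [/\ u != 0, t \notin 1%VS & forall i j, (j < 2)%N -> l (t ^+ j * (u * x i)) = 0].
Proof.
move=> dimK; pose U := <<codom x>>%VS.
have dimU : (\dim U <= n)%N.
  by apply: leq_trans (dim_span _) _; rewrite size_codom card_ord.
have [W dimW annW] := annihilator l U.
have dimW2 : (1 < \dim W)%N.
  by rewrite -(leq_add2r n) add2n (leq_trans dimK) // (leq_trans dimW) // leq_add2l.
pose u := vpick W; have Wu : u \in W by apply: memv_pick.
have nzu : u != 0 by rewrite vpick0 -dimv_eq0 -lt0n ltnW.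
have /subvPn[v Wv uv] : ~~ (W <= <[u]>)%VS.
  by apply/negP => /dimvS; rewrite dim_vline nzu leqNgt dimW2.
have lU w i : w \in W -> l (w * x i) = 0.
  by move=> Ww; rewrite mulrC annW // memv_span // codom_f.
exists u, (v / u); split=> //.
  apply: contra uv => /vlineP[c]; rewrite -in_algE => /(canRL (divfK nzu)) ->.
  by apply/vlineP; exists c; rewrite mulr_algl.
by move=> i [|[|j]] // _; rewrite ?expr0 ?mul1r ?expr1 ?mulrA ?divfK // lU.
Qed.

Lemma adjoin_full (L : {subfield K}) (s : K) p :
  prime p -> \dim {:K} = (p * \dim L)%N -> s \notin L ->
  <<L; s>>%VS = fullv /\ adjoin_degree L s = p.
Proof.
move=> pr_p dimK sL.
have dimLs := dim_Fadjoin L s.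
have dvp : (adjoin_degree L s %| p)%N.
  have := field_dimS (subvf <<L; s>>%AS).
  by rewrite /= dimLs dimK dvdn_pmul2r ?adim_gt0.
have m_p : adjoin_degree L s = p.
  move/(primeP pr_p).2: dvp; rewrite adjoin_deg_eq1 (negPf sL) /= => /eqP //.
by split=> //; apply/eqP; rewrite eqEdim subvf dimK /= dimLs m_p.
Qed.

End Descent.

Section Cubic.
Variables (k : fieldType) (K : fieldExtType k) (n : nat) (F : {mpoly k[n]}).
Hypothesis homF : F \is 3.-homog.

Lemma dim_aspace1 : \dim (1%AS : {subfield K}) = 1%N.
Proof. exact: dimv1. Qed.

Lemma exists_notin (L : {subfield K}) :
  (\dim L < \dim {:K})%N -> exists s, s \notin L.
Proof.
move=> lt; have /subvPn[s _ sL] : ~~ ({:K} <= L)%VS; last by exists s.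
by apply: contraL lt => /dimvS; rewrite -leqNgt.
Qed.

(* A line through two conjugate points meets the cubic in a third point. *)
Lemma quadratic_descent (L : {subfield K}) :
  \dim {:K} = (2 * \dim L)%N -> has_zero (in_alg K) F ->
  exists2 E : fieldExtType k, \dim {:E} = \dim L & has_zero (in_alg E) F.
Proof.
move=> dimK [x nzx Fx].
have [|s sL] := @exists_notin L; first by rewrite dimK -[ltnLHS]mul1n ltn_pmul2r ?adim_gt0.
have [genK m2] := adjoin_full (isT : prime 2) dimK sL.
have [l nzl] := nonzero_functional K.
have [|||||E [c [dimE lec ndc zE]]] :=
    @residual_zero_dual _ _ _ _ _ homF l L s 0 x nzl genK; rewrite ?m2 //.
rewrite m2 in lec; exists E => //; rewrite dimE.
(* [c] is at most 3 * 1 - 2 = 1, and it is not 0 since 3 divides 0. *)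
by case: c lec ndc {dimE} => [|[|c]] //; rewrite ?mul1n.
Qed.

Lemma cubic_zero_dim7 : \dim {:K} = 7%N -> (n <= 5)%N -> has_zero (in_alg K) F ->
  exists2 E : fieldExtType k, \dim {:E} \in [:: 1; 2; 4; 5]%N & has_zero (in_alg E) F.
Proof.
move=> dimK len [x [i0 nzx] Fx].
have [l nzl] := nonzero_functional K.
have [|u [t [nzu t1 lx]]] := @two_annihilators _ K n l x; first by rewrite dimK !ltnS.
have dimK1 : \dim {:K} = (7 * \dim (1%AS : {subfield K}))%N by rewrite dim_aspace1 muln1.
have [genK m7] := adjoin_full (isT : prime 7) dimK1 t1.
have [|||||E [c [dimE lec ndc zE]]] :=
    @residual_zero_dual _ _ _ _ _ homF l (1%AS : {subfield K}) t 2 (fun i => u * x i) nzl genK.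
- by rewrite m7.
- by rewrite m7.
- move=> i a j /vlineP[c ->] j2.
  by rewrite !mulr_algl -scalerAl linearZ /= lx // scaler0.
- by exists i0; rewrite mulf_neq0.
- by rewrite (mmap_dhomog_scale _ _ _ homF) Fx mulr0.
exists E => //; rewrite dimE dim_aspace1 muln1; rewrite m7 in lec.
(* Here e = 4, so [c] is at most 3 * 4 - 7 = 5 and prime to 3. *)
by case: c lec ndc {dimE} => [|[|[|[|[|[|c]]]]]].
Qed.

Lemma cubic_zero_dim8 : \dim {:K} = 8%N -> (n <= 6)%N -> has_zero (in_alg K) F ->
  exists2 E : fieldExtType k, \dim {:E} \in [:: 1; 2; 4; 5; 7]%N & has_zero (in_alg E) F.
Proof.
move=> dimK len zK; have [x [i0 nzx] Fx] := zK.
have sub4 (L : {subfield K}) : \dim L = 4%N ->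
    exists2 E : fieldExtType k, \dim {:E} \in [:: 1; 2; 4; 5; 7]%N & has_zero (in_alg E) F.
  move=> dimL; have [|E dimE zE] := @quadratic_descent L _ zK; first by rewrite dimL.
  by exists E => //; rewrite dimE dimL.
have [l nzl] := nonzero_functional K.
have [|u [t [nzu t1 lx]]] := @two_annihilators _ K n l x; first by rewrite dimK !ltnS.
have Fux : mmap (in_alg K) (fun i => u * x i) F = 0.
  by rewrite (mmap_dhomog_scale _ _ _ homF) Fx mulr0.
have nzux : exists i, u * x i != 0 by exists i0; rewrite mulf_neq0.
have lx1 i a j : a \in 1%VS -> (j < 2)%N -> l (a * t ^+ j * (u * x i)) = 0.
  move=> /vlineP[c ->] j2.
  by rewrite !mulr_algl -scalerAl linearZ /= lx // scaler0.
pose L := <<1; t>>%AS.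
have dimL : \dim L = adjoin_degree 1 t by rewrite /= dim_Fadjoin dimv1 muln1.
have : (\dim L %| 8)%N by rewrite -dimK; apply/field_dimS/subvf.
have : \dim L != 1%N by rewrite dimL adjoin_deg_eq1.
have : \dim L \in divisors 8%N -> \dim L != 1%N ->
    [\/ \dim L = 2%N, \dim L = 4%N | \dim L = 8%N].
  by rewrite !inE => /or4P[] /eqP ->; [|constructor 1|constructor 2|constructor 3].
rewrite -dvdn_divisors // => cases ne1 /cases/(_ ne1)[] dL.
(* L = k(t) is quadratic: an element [s] outside [L] has degree 2 or 4 over it. *)
- have [|s sL] := @exists_notin L; first by rewrite dL dimK.
  have dimLs := dim_Fadjoin L s.
  have : (adjoin_degree L s * 2 %| 4 * 2)%N.
    by rewrite -dL -dimLs dL -[(4 * 2)%N]dimK; apply/(field_dimS (E := {:K}%AS))/subvf.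
  have ne1' : adjoin_degree L s != 1%N by rewrite adjoin_deg_eq1.
  rewrite dvdn_pmul2r // dvdn_divisors // !inE (negPf ne1') /= => /orP[] /eqP m.
    by apply: (sub4 <<L; s>>%AS); rewrite dimLs m dL.
  have genK : <<L; s>>%VS = fullv.
    by apply/eqP; rewrite eqEdim subvf dimLs m dL dimK.
  (* The conditions for 1 and t together say that [l] vanishes on L u x_i: a single condition over
     [L], so r = 1. *)
  have lL a : a \in L -> forall i, l (a * (u * x i)) = 0.
    move=> /Fadjoin_poly_eq <- i; have sz : (size (Fadjoin_poly 1 t a) <= 2)%N.
      by rewrite -dL dimL size_Fadjoin_poly.
    rewrite (horner_coef_wide _ sz) mulr_suml linear_sum big1 // => j _.
    by apply: lx1 => //; apply: (polyOverP (Fadjoin_polyOver _ _ _)).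
  have [|||||E [c [dimE lec ndc zE]]] :=
      @residual_zero_dual _ _ _ _ _ homF l L s 1 (fun i => u * x i) nzl genK;
      rewrite // ?m //.
  - by move=> i a [|j] aL // _; rewrite expr0 mulr1 lL.
  exists E => //; rewrite dimE dL; rewrite m in lec.
  (* Here e = 2 and c <= 3 * 2 - 4 = 2, so [E] has degree 2 or 4 over k. *)
  by case: c lec ndc {dimE} => [|[|[|c]]].
- exact: sub4 dL.
have genK : <<1; t>>%VS = fullv.
  by apply/eqP; rewrite eqEdim subvf dimK dL.
have m8 : adjoin_degree 1 t = 8%N by rewrite -dimL.
have [|||||E [c [dimE lec ndc zE]]] :=
    @residual_zero_dual _ _ _ _ _ homF l (1%AS : {subfield K}) t 2 (fun i => u * x i) nzl genK;
    rewrite // ?m8 //.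
exists E => //; rewrite dimE dim_aspace1 muln1; rewrite m8 in lec.
(* Here e = 5, so c <= 3 * 5 - 8 = 7. *)
by case: c lec ndc {dimE} => [|[|[|[|[|[|[|[|c]]]]]]]].
Qed.

End Cubic.

(** * Closed points and zeros in finite extensions *)

Lemma dhomogXU n (R : nzRingType) (i : 'I_n) : ('X_i : {mpoly R[n]}) \is 1.-homog.
Proof. by rewrite dhomogX /= mdeg1. Qed.

Section FracMod.
Variables (k : fieldType) (n : nat) (P : prime_idealr {mpoly k[n.+1]}).

HB.instance Definition _ := GRing.RMorphism.copy (frac_mod P)
  (@tofrac {ideal_quot P} \o \pi_{ideal_quot P}).

Lemma frac_mod_eq0 f : (frac_mod P f == 0) = (f \in P).
Proof.
rewrite tofrac_eq0 -(raddf0 (\pi_{ideal_quot P})) -Quotient.idealrBE subr0 //.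
Qed.

Lemma frac_mod_mmap (f : {mpoly k[n.+1]}) :
  frac_mod P f = mmap (fun c => frac_mod P c%:MP) (fun i => frac_mod P 'X_i) f.
Proof.
rewrite {1}[f]mpolyE rmorph_sum; apply: eq_bigr => m _.
by rewrite -mul_mpolyC rmorphM mpolyXE_id rmorph_prod; congr (_ * _);
  apply: eq_bigr => i _; rewrite rmorphXn.
Qed.

Lemma frac_mod_dhomog (f : {mpoly k[n.+1]}) d c : f \is d.-homog ->
  mmap (fun a => frac_mod P a%:MP) (fun i => c * frac_mod P 'X_i) f
    = c ^+ d * frac_mod P f.
Proof. by move=> /mmap_dhomog_scale ->; rewrite -frac_mod_mmap. Qed.

Lemma prime_idealr_exp f N : f ^+ N \in P -> f \in P.
Proof.
elim: N => [|N IHN]; first by rewrite expr0 idealr1.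
by rewrite exprS prime_idealrM => /orP[].
Qed.

End FracMod.

(** The coordinates are the ratios of the X_j to an X_i0 outside [P]: fractions of degree 0, hence
    in the image of [iota]. *)
Lemma point_has_zero (k : fieldType) (n : nat) (F : {mpoly k[n.+1]}) D d :
  F \is D.-homog -> has_closed_point_of_degree F d ->
  exists2 K : fieldExtType k, \dim {:K} = d & has_zero (in_alg K) F.
Proof.
move=> homF [P [[homP FP [i0 Xi0]] _] [K [iota [iC resid dimK]]]].
exists K => //; have nz0 : frac_mod P 'X_i0 != 0 by rewrite frac_mod_eq0.
have ex_x j : exists a : K, iota a = (frac_mod P 'X_i0)^-1 * frac_mod P 'X_j.
  have [|a e] := (resid ((frac_mod P 'X_i0)^-1 * frac_mod P 'X_j)).1.
    by exists 1%N, 'X_j, 'X_i0; rewrite !dhomogXU mulrC.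
  by exists a.
have [x xP] := boolp.choice ex_x; exists x.
  by exists i0; rewrite -(fmorph_eq0 iota) xP mulVf ?oner_neq0.
apply/eqP; rewrite -(fmorph_eq0 iota) rmorph_mmap; apply/eqP.
rewrite (eq_mmap (psi := fun c => frac_mod P c%:MP)
  (y := fun j => (frac_mod P 'X_i0)^-1 * frac_mod P 'X_j)).
- by rewrite (frac_mod_dhomog _ homF); apply/eqP; rewrite mulf_eq0 frac_mod_eq0 FP orbT.
- by move=> c /=; rewrite -iC.
- by move=> j /=; rewrite xP.
Qed.

(** * The closed point defined by a zero *)

Section PointOfZero.
Variables (k : fieldType) (n : nat) (E : fieldExtType k) (x : 'I_n.+1 -> E).
Local Notation S := {mpoly k[n.+1]}.

Definition value : S -> E := mmap (in_alg E) x.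
HB.instance Definition _ := GRing.RMorphism.copy value (mmap (in_alg E) x).

(* The restriction of f to the line through x and the origin. *)
Definition cone_restr : S -> {poly E} :=
  mmap (polyC \o in_alg E) (fun i => (x i)%:P * 'X).
HB.instance Definition _ := GRing.RMorphism.copy cone_restr
  (mmap (polyC \o in_alg E) (fun i => (x i)%:P * 'X)).

Lemma coef_cone_restr f d : (cone_restr f)`_d = value (pihomog mdeg d f).
Proof.
rewrite pihomogE rmorph_sum coef_sum [RHS]big_mkcond; apply: eq_bigr => m _ /=.
have -> : mmap1 (fun i => (x i)%:P * 'X) m = (mmap1 x m) *: 'X^(mdeg m).
  rewrite mdegE -prodrXr /mmap1 -mul_polyC rmorph_prod -big_split.
  by apply: eq_bigr => i _; rewrite exprMn rmorphXn.
rewrite coefCM coefZ coefXn eq_sym; case: eqP => _; last by rewrite !mulr0.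
by rewrite mulr1 /value mmapZ mmapX.
Qed.

(** The homogeneous prime of the point [x]. As the kernel of a morphism to the domain E[X] it is
    prime; it is homogeneous because the coefficients of [cone_restr f] are the values of the
    components of [f]. *)
Definition zero_ideal : {pred S} := fun f => cone_restr f == 0.

Fact zero_ideal_idealr : idealr_closed zero_ideal.
Proof.
split; first by rewrite unfold_in rmorph0.
  by rewrite unfold_in rmorph1 oner_neq0.
move=> a u v; rewrite !unfold_in => /eqP u0 /eqP v0.
by rewrite rmorphD rmorphM /= u0 v0 mulr0 addr0.
Qed.

Fact zero_ideal_prime : prime_idealr_closed zero_ideal.
Proof. by move=> u v; rewrite !unfold_in rmorphM mulf_eq0. Qed.

HB.instance Definition _ := isIdealr.Build S zero_ideal zero_ideal_idealr.
HB.instance Definition _ := isPrimeIdealrClosed.Build S zero_ideal zero_ideal_prime.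

Lemma zero_idealE f : reflect (forall d, value (pihomog mdeg d f) = 0) (f \in zero_ideal).
Proof.
rewrite unfold_in; apply: (iffP eqP) => [f0 d|f0]; first by rewrite -coef_cone_restr f0 coef0.
by apply/polyP => d; rewrite coef_cone_restr f0 coef0.
Qed.

Lemma zero_ideal_dhomog f d : f \is d.-homog -> (f \in zero_ideal) = (value f == 0).
Proof.
move=> homf; apply/zero_idealE/eqP => [/(_ d)|f0 e]; first by rewrite pihomog_dE.
have [->|ne] := eqVneq e d; first by rewrite pihomog_dE.
by rewrite (@pihomog_ne0 _ _ _ d) ?rmorph0 // eq_sym.
Qed.

Lemma zero_ideal_homogeneous : homogeneous_ideal zero_ideal.
Proof.
move=> f /zero_idealE f0 d.
by rewrite (zero_ideal_dhomog (pihomogP _ _ _)) f0.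
Qed.

(** The sum is p(f) homogenised by [g], so its value at [x] is p(value f) = 0. This carries
    algebraic relations over k into a homogeneous ideal. *)
Lemma dhomog_relation (p : {poly k}) (f g : S) d :
  f \is d.-homog -> g \is d.-homog -> value g = 1 ->
  root (map_poly (in_alg E) p) (value f) ->
  \sum_(i < size p) p`_i *: (f ^+ i * g ^+ ((size p).-1 - i)) \in zero_ideal.
Proof.
move=> homf homg g1 /rootP pf.
rewrite (@zero_ideal_dhomog _ (d * (size p).-1)).
  rewrite rmorph_sum -[X in _ == X]pf horner_coef size_map_poly.
  apply/eqP/eq_bigr => i _ /=; rewrite {1}/value mmapZ -/(value _) rmorphM !rmorphXn /= g1.
  by rewrite expr1n mulr1 coef_map.
apply: rpred_sum => i _; apply: rpredZ.
rewrite -(subnKC (_ : (i <= (size p).-1)%N)); last first.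
  by have := ltn_ord i; case: (size p) (i : nat).
rewrite mulnDr addKn; apply: dhomogM; exact: dhomogMn.
Qed.

Variable i0 : 'I_n.+1.
Hypothesis x1 : x i0 = 1.

Lemma value_X0 : value 'X_i0 = 1.
Proof. by rewrite /value mmapX mmap1U. Qed.

Lemma zero_ideal_point F D : F \is D.-homog -> value F = 0 -> point_of F zero_ideal.
Proof.
move=> homF F0; split; first exact: zero_ideal_homogeneous.
  by rewrite (zero_ideal_dhomog homF) F0.
exists i0; rewrite (zero_ideal_dhomog (dhomogXU _ i0)) value_X0 oner_neq0 //.
Qed.

Lemma zero_ideal_maximal F (Q : prime_idealr S) :
  point_of F Q -> {subset zero_ideal <= Q} -> {subset Q <= zero_ideal}.
Proof.
move=> [homQ _ [j0 Xj0]] PQ.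
(* Modulo X_i0, the homogenised minimal polynomial of x_j0 is a power of X_j0: having X_i0 in [Q]
   would put X_j0 there. *)
have X0Q : 'X_i0 \notin Q.
  apply: contra Xj0 => X0Q.
  have /polyOver1P[p defp] := minPolyOver 1 (x j0).
  have monp : p \is monic by rewrite -(map_monic (in_alg E)) -defp monic_minPoly.
  have valX : root (map_poly (in_alg E) p) (value 'X_j0).
    by rewrite -defp /value mmapX mmap1U root_minPoly.
  have := PQ _ (dhomog_relation (dhomogXU _ j0) (dhomogXU _ i0) value_X0 valX).
  have : (0 < size p)%N by rewrite size_poly_gt0 monic_neq0.
  move: (monicP monp); rewrite lead_coefE; case: (size p) => // N /= pN _.
  rewrite big_ord_recr /= subnn expr0 mulr1 pN scale1r rpredDl => [/prime_idealr_exp //|].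
  apply: rpred_sum => i _; rewrite -mul_mpolyC idealMr // -(prednK (_ : 0 < N - i)%N).
    by rewrite exprSr !idealMr.
  by rewrite subn_gt0.
(* A component [g] of [f] not vanishing at [x] would force a power of X_i0 into [Q]. *)
move=> f fQ; apply/zero_idealE => d; apply/eqP; apply: contraT => nz.
set g := pihomog mdeg d f in nz.
have gQ : g \in Q by apply: homQ.
have homg : g \is d.-homog by apply: pihomogP.
have valX : value ('X_i0 ^+ d) = 1 by rewrite rmorphXn /= value_X0 expr1n.
have /polyOver1P[p0 defp0] := minPolyOver 1 (value g).
have nzp0 : p0 != 0 by rewrite -(map_poly_eq0 (in_alg E)) -defp0 monic_neq0 ?monic_minPoly.
(* Factors X are split off the minimal polynomial to make the constant term of [p] nonzero;
   [value g], being nonzero, remains a root. *)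
have [m [p]] := multiplicity_XsubC p0 0; rewrite nzp0 subr0 /= => p_0 defp.
have rp : root (map_poly (in_alg E) p) (value g).
  have : root (map_poly (in_alg E) p0) (value g) by rewrite -defp0 root_minPoly.
  rewrite defp rmorphM rootM => /orP[] //.
  by rewrite rmorphXn /= map_polyX /root hornerXn expf_eq0 (negPf nz) andbF.
have hX : ('X_i0 ^+ d : S) \is d.-homog.
  by have := dhomogMn d (dhomogXU k i0); rewrite mul1n.
have := PQ _ (dhomog_relation homg hX valX rp).
have : (0 < size p)%N by rewrite size_poly_gt0; apply: contraNneq p_0 => ->; rewrite root0.
move: p_0; rewrite /root horner_coef0; case: (size p) => // N /= p_0 _.
(* All terms but the constant one contain [g], which lies in [Q]. *)
rewrite big_ord_recl /= expr0 mul1r rpredDr => [|].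
  rewrite subn0 -exprM => XQ; case/negP: X0Q.
  apply: (@prime_idealr_exp _ _ _ _ (d * N)).
  by rewrite -['X_i0 ^+ _](scalerK p_0) -mul_mpolyC idealMr.
apply: rpred_sum => i _; rewrite -mul_mpolyC idealMr // mulrC idealMr // exprSr idealMr //.
Qed.

End PointOfZero.

(** * The residue field of this point *)

Section ResidueField.
Variables (k : fieldType) (n : nat) (E : fieldExtType k) (x : 'I_n.+1 -> E).
Local Notation S := {mpoly k[n.+1]}.
Local Notation ev := (value x).
Local Notation P := (zero_ideal x : prime_idealr S).
Variable i0 : 'I_n.+1.
Hypothesis x1 : x i0 = 1.
Local Notation kappa := <<1 & codom x>>%AS.

Lemma value_mem f : ev f \in kappa.
Proof.
apply: rpred_sum => m _; apply: rpredM.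
  by apply: (subvP (subv_adjoin_seq _ _)); rewrite rpredZ ?mem1v.
apply: rpred_prod => i _; apply: rpredX; apply: seqv_sub_adjoin; exact: codom_f.
Qed.

(** The coordinates are algebraic over k, so the ring they generate is already a field; they are
    adjoined one at a time. *)
Lemma value_surj a : a \in kappa -> exists f, ev f = a.
Proof.
have : {subset codom x <= [pred y | boolp.asbool (exists f, ev f = y)]}.
  move=> _ /codomP[i ->]; rewrite inE; apply/boolp.asboolP; exists 'X_i.
  by rewrite /value mmapX mmap1U.
rewrite /=; elim/last_ind: (codom x) a => [|s y IHs] a sub.
  rewrite Fadjoin_nil => /vlineP[c ->]; exists c%:MP; exact: mmapC.
have {}IHs b : b \in <<1 & s>>%VS -> exists f, ev f = b.
  by apply: IHs => z zs; apply: sub; rewrite mem_rcons inE zs orbT.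
have /boolp.asboolP[g gy] : boolp.asbool (exists f, ev f = y).
  by apply: sub; rewrite mem_rcons mem_head.
rewrite adjoin_rcons => /Fadjoin_polyP[p /polyOverP pP ->]; rewrite horner_coef.
apply: (big_ind (fun b => exists f, ev f = b)).
- by exists 0; rewrite rmorph0.
- by move=> _ _ [f1 <-] [f2 <-]; exists (f1 + f2); rewrite rmorphD.
move=> i _; have [f fi] := IHs _ (pP i); exists (f * g ^+ i).
by rewrite rmorphM rmorphXn /= fi gy.
Qed.

Local Notation fm := (frac_mod P).

(** Substitutes X_j / X_i0 for X_j. Being a ring morphism on all of [S], not only on forms, it
    induces the embedding of k(x) into Frac(S/P). *)
Definition dehomogenization : S -> {fraction {ideal_quot P}} :=
  mmap (fm \o @mpolyC n.+1 k) (fun j => (fm 'X_i0)^-1 * fm 'X_j).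
Local Notation psi := dehomogenization.
HB.instance Definition _ := GRing.RMorphism.copy psi
  (mmap (fm \o @mpolyC n.+1 k) (fun j => (fm 'X_i0)^-1 * fm 'X_j)).

Lemma fmX0 : fm 'X_i0 != 0.
Proof.
by rewrite frac_mod_eq0 (zero_ideal_dhomog _ (dhomogXU _ i0)) value_X0 ?oner_neq0.
Qed.

Lemma dehomogenization_dhomog f d : f \is d.-homog -> psi f = fm f / fm ('X_i0 ^+ d).
Proof.
by move=> homf; rewrite [LHS](frac_mod_dhomog _ homf) rmorphXn mulrC exprVn.
Qed.

(** Powers of X_i0 bring all components to one degree; [ev] and [psi] are 1 at X_i0 and do not
    notice them. *)
Lemma homogenize g : exists D h, [/\ h \is D.-homog, ev h = ev g & psi h = psi g].
Proof.
exists (msize g), (\sum_(d < msize g) 'X_i0 ^+ (msize g - d) * pihomog mdeg d g).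
have defg := @pihomog_partitionE _ _ mdeg (msize g) g (leqnn _).
have psiX : psi 'X_i0 = 1 by rewrite /dehomogenization mmapX mmap1U mulVf ?fmX0.
split.
- apply: rpred_sum => d _.
  suff : 'X_i0 ^+ (msize g - d) * pihomog mdeg d g \is (msize g - d + d).-homog.
    by rewrite subnK ?(ltnW (ltn_ord d)).
  apply: dhomogM; last exact: pihomogP.
  by have := dhomogMn (msize g - d) (dhomogXU k i0); rewrite mul1n.
- rewrite [RHS](congr1 _ defg) !rmorph_sum; apply: eq_bigr => d _ /=.
  by rewrite rmorphM rmorphXn /= value_X0 // expr1n mul1r.
rewrite [RHS](congr1 _ defg) !rmorph_sum; apply: eq_bigr => d _ /=.
by rewrite rmorphM rmorphXn /= psiX expr1n mul1r.
Qed.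

(** The difference may be replaced by a form; its value being 0, that form lies in [P], so its image
    is 0. *)
Lemma dehomogenization_eq f g : ev f = ev g -> psi f = psi g.
Proof.
move=> eq_fg; have [D [h [homh evh psih]]] := homogenize (f - g).
have hP : h \in P by rewrite (zero_ideal_dhomog _ homh) evh rmorphB /= eq_fg subrr.
have : psi (f - g) = 0.
  rewrite -psih (dehomogenization_dhomog homh).
  by move: hP; rewrite -frac_mod_eq0 => /eqP ->; rewrite mul0r.
by rewrite rmorphB => /eqP; rewrite subr_eq0 => /eqP.
Qed.

Lemma zero_ideal_degree : point_degree P (\dim kappa).
Proof.
have ex_rep (a : subvs_of kappa) : exists f, ev f = vsval a.
  exact: value_surj (subvsP a).
have [rep repP] := boolp.choice ex_rep.
(* The choice of representatives is harmless by [dehomogenization_eq], which also yields additivity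
   and multiplicativity. *)
pose iota a := psi (rep a).
have iotaE a f : ev f = vsval a -> iota a = psi f.
  by move=> e; apply: dehomogenization_eq; rewrite repP e.
have iotaB : zmod_morphism iota.
  by move=> a b; rewrite /iota -rmorphB; apply: iotaE; rewrite rmorphB /= !repP.
have iotaM : monoid_morphism iota.
  split; first by rewrite (iotaE _ 1) ?rmorph1 //= algid1.
  by move=> a b; rewrite /iota -rmorphM; apply: iotaE; rewrite rmorphM /= !repP.
pose iZ := GRing.isZmodMorphism.Build _ _ iota iotaB.
pose iM := GRing.isMonoidMorphism.Build _ _ iota iotaM.
pose iotaR : {rmorphism subvs_of kappa -> {fraction {ideal_quot P}}} :=
  HB.pack iota iZ iM.
exists (subvs_of kappa), iotaR; split; last exact: dimvf.
- move=> c; rewrite /iotaR /= (iotaE _ c%:MP) /dehomogenization ?mmapC //.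
  by rewrite /value mmapC /= algid1.
move=> z; split; last first.
  move=> [a ->]; rewrite /iotaR /=; have [f fa] := value_surj (subvsP a).
  rewrite (iotaE _ _ fa); have [D [h [homh _ <-]]] := homogenize f.
  exists D, h, ('X_i0 ^+ D); split=> //.
  - by have := dhomogMn D (dhomogXU k i0); rewrite mul1n.
  - by rewrite -frac_mod_eq0 rmorphXn expf_neq0 ?fmX0.
  exact: dehomogenization_dhomog.
move=> [d [f [g [homf homg gP ->]]]].
have nzg : ev g != 0 by rewrite -(zero_ideal_dhomog _ homg).
have aK : ev f / ev g \in kappa by apply: rpred_div; apply: value_mem.
exists (Subvs aK); rewrite /iotaR /=.
have [r rE] := value_surj aK; rewrite (iotaE _ r) //.
(* [r * g] and [f] have the same value at [x], hence the same image. *)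
have -> : psi r = psi f / psi g.
  have nzpg : psi g != 0.
    rewrite (dehomogenization_dhomog homg) mulf_neq0 ?frac_mod_eq0 //.
    by rewrite invr_eq0 rmorphXn expf_neq0 ?fmX0.
  apply: (canRL (mulfK nzpg)); rewrite -rmorphM; apply: dehomogenization_eq.
  by rewrite rmorphM /= rE divfK.
rewrite (dehomogenization_dhomog homf) (dehomogenization_dhomog homg).
by rewrite -mulf_div divff ?mulr1 // invr_eq0 rmorphXn expf_neq0 ?fmX0.
Qed.

End ResidueField.

(** With one coordinate normalised to 1, the residue field of the point is k(x), a subfield of [E],
    so its degree divides that of [E]. *)
Lemma zero_has_point (k : fieldType) (n : nat) (F : {mpoly k[n.+1]}) D
    (E : fieldExtType k) :
  F \is D.-homog -> has_zero (in_alg E) F ->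
  exists2 d, (d %| \dim {:E})%N & has_closed_point_of_degree F d.
Proof.
move=> homF [y [i0 nzy] Fy]; pose x i := (y i0)^-1 * y i.
have x1 : x i0 = 1 by rewrite /x mulVf.
have Fx : value x F = 0 by rewrite /value (mmap_dhomog_scale _ _ _ homF) Fy mulr0.
exists (\dim <<1 & codom x>>%AS); first exact/field_dimS/subvf.
exists (zero_ideal x : prime_idealr _); last exact: (zero_ideal_degree x1).
have pt := zero_ideal_point x1 homF Fx.
by split=> // Q; apply: (zero_ideal_maximal x1).
Qed.

Local Close Scope quotient_scope.
Local Close Scope ring_scope.

Theorem theorem3p6 (k : fieldType) :
  (forall F : {mpoly k[5.+1]},
      smooth_cubic_hypersurface F ->
      has_closed_point_of_degree F 8 ->
      exists2 d : nat, d \in [:: 1; 2; 4; 5; 7]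
                     & has_closed_point_of_degree F d) /\
  (forall F : {mpoly k[4.+1]},
      smooth_cubic_hypersurface F ->
      has_closed_point_of_degree F 7 ->
      exists2 d : nat, d \in [:: 1; 2; 4; 5]
                     & has_closed_point_of_degree F d).
Proof.
(* A zero in [E] gives a point whose degree merely divides that of [E]; both lists contain all
   divisors of their members. *)
have divisor_closed (s : seq nat) (E : fieldExtType k) d :
    all (fun e => all (mem s) (divisors e)) s -> \dim {:E} \in s ->
    (d %| \dim {:E})%N -> d \in s.
  move=> /allP cl /cl/allP; rewrite dvdn_divisors ?(adim_gt0 {:E}%AS) //; exact.
split=> F [_ homF _] /(point_has_zero homF)[K dimK zK].
  have [E dimE zE] := cubic_zero_dim8 homF dimK isT zK.
  have [d dE pd] := zero_has_point homF zE; exists d => //.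
  exact: divisor_closed dimE dE.
have [E dimE zE] := cubic_zero_dim7 homF dimK isT zK.
have [d dE pd] := zero_has_point homF zE; exists d => //.
exact: divisor_closed dimE dE.
Qed.
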